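(* Let $X,P\in\mathbb{C}^{d\times d}$ with $P\succ0$ and $PX=XP$. Then the Neumann series $\sum_{k=0}^\infty X^k$ is $(\mathsf{E},P)$-summable to $(I-X)^{-1}$ if and only if $\lambda\bigl((I+P)^{-1}(P+X)\bigr)\subseteq\mathbb{D}$.
   Context: $\lambda(Y)$ is the set of eigenvalues of $Y$; $\mathbb{D}=\{z\in\mathbb{C}:|z|<1\}$. $P\succ0$ means $P$ is positive definite: $x^*Px>0$ for all nonzero $x\in\mathbb{C}^d$ (so $P$ is Hermitian). A series of matrices equals $S$ in the conventional sense if its partial sums converge to $S$ (in any matrix norm). For $P\succ0$ and a sequence $A_\bullet=(A_k)_{k=0}^\infty$ in $\mathbb{C}^{d\times d}$, the $P$-Euler transform is $$\mathscr{E}^P_n(A_\bullet)=\sum_{k=0}^n\binom nk(I+P)^{-n-1}P^{n-k}A_k,\qquad n\ge0.$$ The series $\sum_{k=0}^\infty A_k$ is $(\mathsf{E},P)$-summable to $S$ if $\sum_{n=0}^\infty\mathscr{E}^P_n(A_\bullet)=S$ in the conventional sense. The assertion that the series is summable to $(I-X)^{-1}$ is understood to include that $I-X$ is invertible. *)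

(* Defs.v *)
From HB Require Import structures.
From mathcomp Require Import all_boot all_order all_algebra.
From mathcomp Require Import spectral complex.
From mathcomp Require Import all_classical all_reals all_analysis.

Set Implicit Arguments.
Unset Strict Implicit.
Unset Printing Implicit Defensive.

Import Order.TTheory GRing.Theory Num.Theory.
Import numFieldNormedType.Exports.

Local Open Scope classical_set_scope.
Local Open Scope ring_scope.
Local Open Scope sesquilinear_scope.

(* Kept as a numClosedFieldType rather than the bare type R[i], so that the   *)
(* topology of the modulus is found on it, and with it the max-norm topology  *)
(* on matrices.                                                               *)
Definition Cplx (R : realType) : numClosedFieldType := R[i]%C.

Definition unit_disc (C : numClosedFieldType) : set C := [set z | `|z| < 1].

Definition spectrum (C : numClosedFieldType) (d : nat) (Y : 'M[C]_d) : set C :=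
  [set z | eigenvalue Y z].

(* In the partial order of C, 0 < z entails that z is real; hence positive    *)
(* definite matrices are Hermitian.                                           *)
Definition posdefmx (C : numClosedFieldType) (d : nat) (P : 'M[C]_d) : Prop :=
  forall x : 'cV[C]_d, x != 0 -> 0 < (x ^t* *m P *m x) 0 0.

(* invmx A is A when A is singular; 1%:M + P is invertible for P positive     *)
(* definite, the only case of interest.                                       *)
Definition euler_transform (C : numClosedFieldType) (d : nat) (P : 'M[C]_d)
    (A : nat -> 'M[C]_d) : nat -> 'M[C]_d := fun n =>
  \sum_(0 <= k < n.+1)
    (invmx (1%:M + P) ^+ n.+1 *m P ^+ (n - k) *m A k) *+ 'C(n, k).

Definition euler_summable (C : numClosedFieldType) (d : nat) (P : 'M[C]_d)
    (A : nat -> 'M[C]_d) (S : 'M[C]_d) : Prop :=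
  series (euler_transform P A) n @[n --> \oo] --> S.

(* Main.v *)
Require Import Defs.
From HB Require Import structures.
From mathcomp Require Import all_boot all_order all_algebra.
From mathcomp Require Import spectral complex.
From mathcomp Require Import all_classical all_reals all_analysis.
From mathcomp Require Import ring.

Import Order.TTheory GRing.Theory Num.Theory.
Import numFieldNormedType.Exports.

Local Open Scope classical_set_scope.
Local Open Scope ring_scope.

(** The weight Q = (1 + P)^-1 commutes with P and X, so the binomial theorem
    collapses the n-th term of the Euler transform of the powers of X to
    Q Y^n, where Y = Q (P + X).  The transformed series is thus the Neumann
    series of Y up to the factor Q, and since 1 - Y = Q (1 - X) it telescopes:
    (1 - X) (Q Y^0 + ... + Q Y^(n-1)) = 1 - Y^n.

    Summability to the inverse of 1 - X therefore forces Y^n -> 0, which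
    confines the eigenvalues of Y to the open disc ([cvg_expmx_spectrum]).
    Conversely, if the spectrum of Y lies in the open disc, then 1 is not an
    eigenvalue of Y, so 1 - Y and with it 1 - X are invertible, and the partial
    sums (1 - X)^-1 (1 - Y^n) converge to (1 - X)^-1 as soon as Y^n -> 0.

    That Y^n -> 0 ([spectrum_cvg_expmx]) needs no norm adapted to Y: by the
    Cayley-Hamilton theorem some product of factors Y - z with |z| < 1
    vanishes, and the factors can be stripped one at a time
    ([mulmx_exp_cvg0]), because a solution of a (n + 1) = z a n + b n tends
    to 0 whenever |z| < 1 and b does ([affine_rec_cvg0]). *)

(** * Limits of matrices *)

Lemma cvg_mxP (K : numFieldType) (T : Type) (F : set_system T) (FF : Filter F)
    (m n : nat) (f : T -> 'M[K]_(m, n)) (M : 'M[K]_(m, n)) :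
  f x @[x --> F] --> M <-> forall i j, f x i j @[x --> F] --> M i j.
Proof.
split=> [fM i j|fM].
  exact: (cvg_comp _ _ fM (@coord_continuous K m n i j M)).
apply/cvg_ballP => e e0.
have : \forall x \near F, forall ij : 'I_m * 'I_n,
    ball (M ij.1 ij.2) e (f x ij.1 ij.2).
  apply: filter_forall => -[i j] /=.
  by move/cvg_ballP : (fM i j); exact.
by apply: filterS => x Hx; split => // i j; exact: (Hx (i, j)).
Qed.

Lemma cvg_mulmxl (K : numFieldType) (T : Type) (F : set_system T)
    (FF : Filter F) (m n p : nat) (A : 'M[K]_(m, n)) (f : T -> 'M[K]_(n, p))
    (M : 'M[K]_(n, p)) :
  f x @[x --> F] --> M -> A *m f x @[x --> F] --> A *m M.
Proof.
move=> /cvg_mxP fM; apply/cvg_mxP => i j; rewrite mxE.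
under eq_fun do rewrite mxE.
by apply: cvg_big => [|k _]; [exact: add_continuous|exact: cvgMl_tmp].
Qed.

(** * Powers of complex numbers and of complex matrices *)

(** Moduli and positive radii are real, so the claim reduces to geometric
    sequences of real numbers, where the archimedean property applies. *)
Lemma Cplx_cvg_expr (R : realType) (z : Cplx R) :
  `|z| < 1 -> z ^+ n @[n --> \oo] --> (0 : Cplx R).
Proof.
move=> z1.
have nnegE (x : R[i]) : 0 <= x -> x = (complex.Re x)%:C%C.
  by case: x => a b; rewrite lecE /= => /andP[/eqP ->].
have zr := nnegE _ (normr_ge0 z : 0 <= (`|z| : R[i])).
set r := complex.Re _ in zr.
have r0 : 0 <= r by rewrite -lecR -zr normr_ge0.
have r1 : `|r| < 1 by rewrite ger0_norm// -ltcR -zr.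
apply/cvgr0Pnorm_lt => e e0; have er := nnegE _ (ltW e0).
have e1 : 0 < complex.Re e by rewrite -ltcR -er.
move/cvgr0Pnorm_lt : (cvg_expr r1) => /(_ _ e1).
apply: filterS => n; rewrite normrX ger0_norm// => rn.
by rewrite normrX er zr -(rmorphXn (real_complex R)) ltcR.
Qed.

(** Once [`|b n|] is below e (1 - |z|), the excess of [`|a n|] over e shrinks
    at least by the factor |z| at each step. *)
Lemma affine_rec_cvg0 (R : realType) (V : normedModType (Cplx R))
    (z : Cplx R) (a b : nat -> V) :
  `|z| < 1 -> (forall n, a n.+1 = z *: a n + b n) ->
  b n @[n --> \oo] --> (0 : V) -> a n @[n --> \oo] --> (0 : V).
Proof.
move=> z1 ab /cvgr0Pnorm_le b0; apply/cvgr0Pnorm_le => e e0.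
have e2 : 0 < e / 2 by rewrite divr_gt0.
have e1 : 0 < e / 2 * (1 - `|z|) by rewrite mulr_gt0// subr_gt0.
have [N _ bN] := b0 _ e1.
have step k : `|a (k + N)%N| <= e / 2 + `|z| ^+ k * `|a N|.
  elim: k => [|k IH]; first by rewrite add0n expr0 mul1r lerDr ltW.
  rewrite addSn ab (le_trans (ler_normD _ _))// normrZ.
  have := bN _ (leq_addl k N) => /= bk.
  apply: (le_trans (lerD (ler_wpM2l (normr_ge0 z) IH) bk)).
  by rewrite exprS le_eqVlt; apply/orP; left; apply/eqP; ring.
have c0 : `|a N| * z ^+ k @[k --> \oo] --> (0 : Cplx R).
  by rewrite -(mulr0 `|a N|); apply: cvgMl_tmp; exact: Cplx_cvg_expr.
move/cvgr0Pnorm_le : c0 => /(_ _ e2) [M _ cM].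
exists (M + N)%N => // n /= Mn.
have Nn : (N <= n)%N by rewrite (leq_trans _ Mn)// leq_addl.
rewrite -(subnK Nn) (le_trans (step _))// [leRHS](splitr e) lerD2l.
have /cM /= : (M <= n - N)%N by rewrite leq_subRL// addnC.
by rewrite normrM normr_id normrX mulrC.
Qed.

(** The first factor Y - z is moved into M: the sequence a n = M Y^n satisfies
    a (n + 1) = z a n + M (Y - z) Y^n, whose inhomogeneous term tends to 0 by
    induction.  Letting M vary in the induction is what makes this work. *)
Lemma mulmx_exp_cvg0 (R : realType) (m d : nat) (Y : 'M[Cplx R]_d)
    (s : seq (Cplx R)) (M : 'M[Cplx R]_(m, d)) :
  (forall z, z \in s -> `|z| < 1) ->
  M *m (\prod_(z <- s) (Y - z%:M)) = 0 ->
  M *m Y ^+ n @[n --> \oo] --> (0 : 'M[Cplx R]_(m, d)).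
Proof.
elim: s M => [|z s IH] M s1.
  rewrite big_nil mulmx1 => ->.
  by under eq_fun do rewrite mul0mx; exact: cvg_cst.
rewrite big_cons mulmxA => Ms.
apply: (@affine_rec_cvg0 _ _ z _ (fun n => M *m (Y - z%:M) *m Y ^+ n)).
- by apply: s1; rewrite mem_head.
- move=> n; rewrite exprS mulmxA mulmxBr mulmxBl mul_mx_scalar scalemxAl.
  by rewrite addrC subrK.
- by apply: IH => // x xs; apply: s1; rewrite inE xs orbT.
Qed.

Lemma spectrum_cvg_expmx (R : realType) (d : nat) (Y : 'M[Cplx R]_d) :
  spectrum Y `<=` @unit_disc (Cplx R) ->
  Y ^+ n @[n --> \oo] --> (0 : 'M[Cplx R]_d).
Proof.
case: d Y => [|d] Y Ydisc.
  by under eq_fun do rewrite [_ ^+ _]flatmx0; exact: cvg_cst.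
have [s Ys] := closed_field_poly_normal (char_poly Y).
rewrite (monicP (char_poly_monic Y)) scale1r in Ys.
have s1 z : z \in s -> `|z| < 1.
  by move=> zs; apply: Ydisc; rewrite /spectrum/= eigenvalue_root_char Ys
    root_prod_XsubC.
have Y0 : \prod_(z <- s) (Y - z%:M) = 0.
  rewrite -(Cayley_Hamilton Y) Ys rmorph_prod; apply: eq_bigr => z _.
  by rewrite rmorphB /= horner_mx_X horner_mx_C.
have := @mulmx_exp_cvg0 _ _ _ Y s 1%:M s1.
rewrite Y0 mulmx0 => /(_ erefl).
by under eq_fun do rewrite mul1mx.
Qed.

(** A left eigenvector v of Y for z turns Y^n -> 0 into z^n v -> 0, while
    |z^n v| >= |v| when |z| >= 1. *)
Lemma cvg_expmx_spectrum (R : realType) (d : nat) (Y : 'M[Cplx R]_d) :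
  Y ^+ n @[n --> \oo] --> (0 : 'M[Cplx R]_d) ->
  spectrum Y `<=` @unit_disc (Cplx R).
Proof.
move=> Y0 z /eigenvalueP[v vY v0].
have vYn n : v *m Y ^+ n = z ^+ n *: v.
  elim: n => [|n IH]; first by rewrite expr0 mulmx1 scale1r.
  by rewrite exprS mulmxA vY -scalemxAl IH scalerA -exprS.
have : v *m Y ^+ n @[n --> \oo] --> v *m (0 : 'M[Cplx R]_d).
  exact: cvg_mulmxl.
rewrite mulmx0 => /cvgr0Pnorm_lt.
have nv0 : 0 < `|v| by rewrite normr_gt0.
move=> /(_ _ nv0)[N _ /(_ _ (leqnn N))] /=.
rewrite vYn normrZ normrX gtr_pMl//.
rewrite /unit_disc /= => zN.
rewrite real_ltNge ?normr_real// ?real1//.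
by apply/negP => z1; move: (lt_le_trans zN (exprn_ege1 N z1)); rewrite ltxx.
Qed.

(** * The Euler transform of the powers of a matrix *)

(** 1 + P is itself positive definite, and -1 cannot be an eigenvalue of P:
    v P = - v makes v P v^* both positive and nonpositive. *)
Lemma posdefmx_unitmx1D (C : numClosedFieldType) (d : nat) (P : 'M[C]_d) :
  posdefmx P -> 1%:M + P \in unitmx.
Proof.
move=> Ppos; rewrite -row_free_unit -kermx_eq0; apply/eqP/row_matrixP => i.
rewrite row0; set v := row i _; apply/eqP/negPn/negP => v0.
have vP : v *m (1%:M + P) = 0.
  by apply/sub_kermxP; exact: row_sub.
have {}vP : v *m P = - v.
  by apply/eqP; rewrite -addr_eq0 addrC -{1}[v]mulmx1 -mulmxDr vP.
have /Ppos : (v ^t*)%sesqui != 0.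
  by apply: contra v0 => /eqP v0; rewrite -[v]trmxCK v0 trmx0 map_mx0.
rewrite trmxCK vP mulNmx mxE oppr_gt0 -dotmxE.
by rewrite le_gtF// dnorm_ge0.
Qed.

Lemma invmx_commr (F : comUnitRingType) (d : nat) (A B : 'M[F]_d) :
  A \in unitmx -> A *m B = B *m A -> invmx A *m B = B *m invmx A.
Proof.
move=> Au AB; apply: (canRL (mulmxK Au)).
by rewrite -mulmxA -AB mulmxA mulVmx// mul1mx.
Qed.

(** Binomial theorem in the commutative subalgebra generated by P and X. *)
Lemma euler_transform_powers (C : numClosedFieldType) (d : nat)
    (P X : 'M[C]_d) (n : nat) :
  P *m X = X *m P -> 1%:M + P \in unitmx ->
  euler_transform P (fun k => X ^+ k) n =
  invmx (1%:M + P) *m (invmx (1%:M + P) *m (P + X)) ^+ n.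
Proof.
move=> PX uP; set Q := invmx _.
have QPX : GRing.comm Q (P + X).
  apply: invmx_commr => //.
  by rewrite !mulmxDl !mulmxDr !mul1mx !mulmx1 PX addrACA.
rewrite /euler_transform (exprMn_comm _ QPX) (exprDn_comm _ PX).
rewrite mulmxA -[Q *m Q ^+ n]exprS mulmx_sumr big_mkord.
by apply: eq_bigr => k _; rewrite raddfMn /= mulmxA.
Qed.

Lemma one_sub_invmxM (F : comUnitRingType) (d : nat) (P X : 'M[F]_d) :
  1%:M + P \in unitmx ->
  1%:M - invmx (1%:M + P) *m (P + X) = invmx (1%:M + P) *m (1%:M - X).
Proof.
by move=> uP; rewrite -{1}(mulVmx uP) -mulmxBr opprD addrA addrK.
Qed.

(** The telescoping identity: the factor Q of each Euler term turns 1 - X into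
    1 - Y, and (1 - Y) (1 + Y + ... + Y^(n-1)) = 1 - Y^n. *)
Lemma mul_series_euler (C : numClosedFieldType) (d : nat)
    (P X : 'M[C]_d) (n : nat) :
  P *m X = X *m P -> 1%:M + P \in unitmx ->
  (1%:M - X) *m series (euler_transform P (fun k => X ^+ k)) n =
  1%:M - (invmx (1%:M + P) *m (P + X)) ^+ n.
Proof.
move=> PX uP.
have QX : invmx (1%:M + P) *m (1%:M - X) = (1%:M - X) *m invmx (1%:M + P).
  apply: invmx_commr => //.
  by rewrite !mulmxDl !mulmxDr !mulNmx !mulmxN !mul1mx !mulmx1 PX addrACA.
rewrite seriesEnat/= mulmx_sumr.
under eq_bigr do rewrite euler_transform_powers// mulmxA -QX -one_sub_invmxM//.
rewrite -mulmx_sumr big_mkord; set Y := _ *m (P + X).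
by have /(congr1 -%R) := subrX1 Y n; rewrite -mulNr !opprB => ->.
Qed.

Theorem proposition3p10 (R : realType) (d : nat) (X P : 'M[Cplx R]_d)
    (Ppos : posdefmx P) (PX : P *m X = X *m P) :
  (1%:M - X \in unitmx /\
   euler_summable P (fun k => X ^+ k) (invmx (1%:M - X)))
  <-> spectrum (invmx (1%:M + P) *m (P + X)) `<=` @unit_disc (Cplx R).
Proof.
have uP := posdefmx_unitmx1D _ _ _ Ppos.
have sumE n := mul_series_euler _ _ _ _ n PX uP.
set Y := invmx (1%:M + P) *m (P + X) in sumE *.
split=> [[uX sumX]|Ydisc].
  apply: cvg_expmx_spectrum.
  have -> : (fun n => Y ^+ n) = (fun n => 1%:M -
      (1%:M - X) *m series (euler_transform P (fun k => X ^+ k)) n).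
    by apply/funext => n; rewrite sumE opprB addrC subrK.
  have -> : 0 = 1%:M - (1%:M - X) *m invmx (1%:M - X) by rewrite mulmxV// subrr.
  by apply: cvgB; [exact: cvg_cst|apply: cvg_mulmxl; exact: sumX].
have uX : 1%:M - X \in unitmx.
  have : 1%:M - Y \in unitmx.
    rewrite -row_free_unit -kermx_eq0.
    apply/negPn/negP => /rowV0Pn[v /sub_kermxP vY v0].
    have : `|1 : Cplx R| < 1.
      apply: Ydisc; apply/eigenvalueP; exists v => //.
      apply/eqP; rewrite scale1r eq_sym -subr_eq0.
      by rewrite -{1}[v]mulmx1 -mulmxBr vY.
    by rewrite normr1 ltxx.
  by rewrite one_sub_invmxM// unitmx_mul => /andP[].
split=> //; rewrite /euler_summable.
have -> : series (euler_transform P (fun k => X ^+ k)) =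
    (fun n => invmx (1%:M - X) *m (1%:M - Y ^+ n)).
  by apply/funext => n; rewrite -sumE mulKmx.
rewrite -[X in _ --> X]mulmx1 -[X in _ *m X]subr0.
apply: cvg_mulmxl; apply: cvgB; first exact: cvg_cst.
exact: spectrum_cvg_expmx.
Qed.
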